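(* There exist nonnegative functions $f_n, g_n \in L_1(\mathbb{T})$, $n \in \mathbb{N}$, with $\log f_n, \log g_n \in L_1(\mathbb{T})$ (so that their spectral factors $f_n^+, g_n^+$ are defined), such that $$ \|f_n\|_{L_1}\le 1,\quad \|g_n\|_{L_1} \le 1, \quad \|g_n - f_n\|_{L_1} \le \frac1n, \quad \|\log g_n - \log f_n\|_{L_1} \le \frac1n, $$ but $$ \|g_n^+ - f_n^+\|_{H_2} \ge 2 - \frac1n . $$
   Context: $\mathbb{T}$ is the unit circle, parametrized by $e^{i\vartheta}$, $\vartheta\in[-\pi,\pi)$. Norms are unnormalized: $\|h\|_{L_1}=\int_{-\pi}^{\pi}|h(e^{i\vartheta})|\,d\vartheta$, and for $F$ in the Hardy space $H_2(\mathbb{D})$, $\|F\|_{H_2}^2=\int_{-\pi}^{\pi}|F(e^{i\vartheta})|^2\,d\vartheta$, where $F(e^{i\vartheta})$ denotes the a.e. radial boundary values. For a nonnegative $f\in L_1(\mathbb{T})$ with $\log f\in L_1(\mathbb{T})$, its spectral factor is the outer function $$ f^+(z)=\exp\left(\frac 1{4\pi}\int_0^{2\pi}\frac{e^{i\theta}+z}{e^{i\theta}-z}\log f(e^{i\theta})\,d\theta\right),\quad |z|<1, $$ which belongs to $H_2(\mathbb{D})$, is positive at the origin, and satisfies $|f^+|^2=f$ a.e. on $\mathbb{T}$. *)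

(* Defs.v *)
From HB Require Import structures.
From mathcomp Require Import all_boot all_order all_algebra.
From mathcomp Require Import all_classical all_reals all_analysis.
From mathcomp Require Import complex.
Set Implicit Arguments. Unset Strict Implicit. Unset Printing Implicit Defensive.
Import Order.TTheory GRing.Theory Num.Theory.
Import numFieldTopology.Exports numFieldNormedType.Exports.
Local Open Scope classical_set_scope.
Local Open Scope ring_scope.
Local Open Scope complex_scope.

Section Defs.
Variable R : realType.
Local Notation C := R[i].
Local Notation mu := (@lebesgue_measure R).

Definition expi (t : R) : C := Complex (cos t) (sin t).

Definition cexp (z : C) : C := (expR (complex.Re z))%:C * expi (complex.Im z).

Definition cintegral (D : set R) (h : R -> C) : C :=
  (Rintegral mu D (fun t => complex.Re (h t)))%:C + 'i * (Rintegral mu D (fun t => complex.Im (h t)))%:C.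

Definition L1T (h : C -> R) : Prop :=
  mu.-integrable `[- pi, pi]%classic (fun t => (h (expi t))%:E).

Definition normL1 (h : C -> R) : R :=
  Rintegral mu `[- pi, pi]%classic (fun t => `|h (expi t)|).

(* log f in L_1(T); log f is finite a.e. (i.e. f > 0 a.e.) and integrable *)
Definition logL1T (f : C -> R) : Prop :=
  (\forall t \ae mu, `[- pi, pi]%classic t -> 0 < f (expi t)) /\
  L1T (fun z => ln (f z)).

Definition spectral_factor (f : C -> R) (z : C) : C :=
  cexp (((4 * pi)^-1)%:C *
    cintegral `[0, 2 * pi]%classic
      (fun t => (expi t + z) / (expi t - z) * (ln (f (expi t)))%:C)).

Definition boundary (F : C -> C) (t : R) : C :=
  @lim (C : numClosedFieldType) ((fun r : R => F (r%:C * expi t)) @ (1:R)^'-).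

Definition normH2 (F : C -> C) : R :=
  Num.sqrt (Rintegral mu `[- pi, pi]%classic
    (fun t => complex.Re (boundary F t) ^+ 2 + complex.Im (boundary F t) ^+ 2)).

End Defs.

(* Main.v *)
Require Import Defs.
From HB Require Import structures.
From mathcomp Require Import all_boot all_order all_algebra.
From mathcomp Require Import all_classical all_reals all_analysis.
From mathcomp Require Import complex.
From mathcomp Require Import ring lra.
Import Order.TTheory GRing.Theory Num.Theory.
Import numFieldTopology.Exports numFieldNormedType.Exports.
Local Open Scope ring_scope.

(* Write [x = 1/n].  Let [f = c exp (K cos t)], normalised so that its integral
   is 1, and [g = f exp (2 Re w)] on the circle with
   [w z = - d (1 + a z) / (1 - a z)], [|a| < 1], [d = x / (4 pi)].  Then [Re w] is
   minus a multiple of a Poisson kernel, so [||log g - log f|| = 4 pi d = x]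
   whatever [a] is, and [a] can be chosen so that [w 1 = - (q + i pi)] with [q]
   small.  The spectral factors are explicit, with [g^+ = f^+ exp w].  As [K]
   grows, [f dt] concentrates at [t = 0], so [||g - f||] tends to
   [1 - exp (- 2 q)] and [||g^+ - f^+||] tends to [|exp (w 1) - 1| = 1 + exp (- q)]. *)

Set Implicit Arguments.
Unset Strict Implicit.
Unset Printing Implicit Defensive.

(** The obstacle the example exploits: up to a constant factor, the phase of a spectral factor is
    the conjugate function of [log f], and conjugation is unbounded on L_1. A Poisson kernel of
    small mass has an analytic completion whose imaginary part still takes arbitrarily large values
    on the circle, so a perturbation of [log f] of size [x] can turn the phase by pi at a point.
    Where that happens [g^+] is almost [- f^+], whence the constant 2. The turn is confined to a
    short arc, so [f] must carry almost all its mass there; this forces the order of choices: [a]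
    depends on [x] only, and [K] is taken afterwards, depending on the modulus of continuity of
    [exp w] at [t = 0]. Both logarithms are real parts, on the circle, of rational functions
    analytic on the closed disc. The Schwarz integral can therefore be evaluated from its
    definition, by partial fractions, once the integrals of [e^{imt}] and of [1 / (e^{it} - b)],
    [|b| < 1], are known; Cauchy's formula is not invoked. *)

(** * Real integrals of continuous functions over a segment *)

Section RealIntegrals.
Local Open Scope classical_set_scope.
Local Open Scope ring_scope.
Local Open Scope complex_scope.
Variable R : realType.
Local Notation mu := (@lebesgue_measure R).
Implicit Types (f g : R -> R) (a b : R).

Lemma cts_integrable f a b : continuous f ->
  mu.-integrable `[a, b] (EFin \o f).
Proof.
move=> cf; apply: continuous_compact_integrable; first exact: segment_compact.
exact: continuous_subspaceT.
Qed.

Lemma ctsRintegralD f g a b : continuous f -> continuous g ->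
  \int[mu]_(x in `[a, b]) (f x + g x) =
  \int[mu]_(x in `[a, b]) f x + \int[mu]_(x in `[a, b]) g x.
Proof. by move=> cf cg; rewrite RintegralD//; exact: cts_integrable. Qed.

Lemma ctsRintegralZ (k : R) f a b : continuous f ->
  \int[mu]_(x in `[a, b]) (k * f x) = k * \int[mu]_(x in `[a, b]) f x.
Proof. by move=> cf; rewrite RintegralZl//; exact: cts_integrable. Qed.

Lemma cts_le_Rintegral f g a b : continuous f -> continuous g ->
  (forall x, x \in `[a, b] -> f x <= g x) ->
  \int[mu]_(x in `[a, b]) f x <= \int[mu]_(x in `[a, b]) g x.
Proof.
by move=> cf cg fg; apply: le_Rintegral => //; exact: cts_integrable.
Qed.

Lemma Rintegral_cst_itv (k : R) a b : a <= b ->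
  \int[mu]_(x in `[a, b]) k = k * (b - a).
Proof.
move=> ab; rewrite Rintegral_cst//=. rewrite (lebesgue_measure_itv `[a, b])/= lte_fin.
by case: ltgtP ab => [|//|->] _; rewrite ?subrr.
Qed.

Lemma cts_le_Rintegral_sub f a b a' b' : continuous f -> (forall x, 0 <= f x) ->
  a <= a' -> b' <= b ->
  \int[mu]_(x in `[a', b']) f x <= \int[mu]_(x in `[a, b]) f x.
Proof.
move=> cf f0 aa bb; rewrite /Rintegral fine_le//.
- exact: integrable_fin_num (cts_integrable _ _ _).
- exact: integrable_fin_num (cts_integrable _ _ _).
apply: ge0_subset_integral => //=.
- exact: measurable_int (cts_integrable _ _ _).
- by move=> x _; rewrite lee_fin.
- by move=> x /=; rewrite !in_itv/= => /andP[? ?]; apply/andP; split; lra.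
Qed.

Lemma Rintegral_derive (F f : R -> R) a b : a < b -> continuous f ->
  (forall x : R, is_derive x 1 F (f x)) -> \int[mu]_(x in `[a, b]) f x = F b - F a.
Proof.
move=> ab cf dF; have cF : continuous F.
  move=> x; apply/differentiable_continuous/derivable1_diffP.
  exact: (@ex_derive _ _ _ _ _ _ _ (dF x)).
rewrite /Rintegral (@continuous_FTC2 _ f F)//.
- exact: continuous_subspaceT.
- split.
  + by move=> x _; exact: (@ex_derive _ _ _ _ _ _ _ (dF x)).
  + exact/cvg_at_right_filter/cF.
  + exact/cvg_at_left_filter/cF.
- by move=> x _; rewrite derive1E; exact: (@derive_val _ _ _ _ _ _ _ (dF x)).
Qed.

End RealIntegrals.

(** * The parametrization of the unit circle *)

Section Expi.
Local Open Scope classical_set_scope.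
Local Open Scope ring_scope.
Local Open Scope complex_scope.
Variable R : realType.
Implicit Types (t : R).

Lemma expi0 : expi (0 : R) = 1.
Proof. by rewrite /expi cos0 sin0. Qed.

Lemma expiD t s : expi (t + s) = expi t * expi s.
Proof. by rewrite /expi cosD sinD; simpc; congr (_ +i* _); ring. Qed.

Lemma expiX t k : expi t ^+ k = expi (k%:R * t).
Proof.
elim: k => [|k IH]; first by rewrite mul0r expi0 expr0.
by rewrite exprS IH -expiD -natr1 mulrDl mul1r addrC.
Qed.

Lemma norm_expi t : `|expi t| = 1.
Proof. by rewrite normc_def/= cos2Dsin2 sqrtr1. Qed.

Lemma expi_neq0 t : expi t != 0.
Proof. by rewrite -normr_eq0 norm_expi oner_eq0. Qed.

Lemma conj_expi t : (expi t)^* = (expi t)^-1.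
Proof.
by rewrite invc_norm norm_expi expr1n invr1 mul1r.
Qed.

Lemma expi_sub_neq0 t (b : R[i]) : `|b| < 1 -> expi t - b != 0.
Proof.
move=> b1; rewrite subr_eq0; apply: contraTneq b1 => <-.
by rewrite norm_expi ltxx.
Qed.

Lemma oneB_neq0 t (a : R[i]) : `|a| < 1 -> 1 - a * expi t != 0.
Proof.
move=> a1; rewrite subr_eq0; apply: contraTneq a1 => h.
by have := normrM a (expi t); rewrite norm_expi mulr1 -h normr1 => <-; rewrite ltxx.
Qed.

Lemma expi2pi t : expi (t + 2 * pi) = expi t.
Proof.
by rewrite expiD /expi [2 * _]mulrC mulr_natr cos2pi sin2pi mulr1.
Qed.

End Expi.

(** * Limits and continuity of complex-valued functions *)

Section Cts.
Local Open Scope classical_set_scope.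
Local Open Scope ring_scope.
Local Open Scope complex_scope.
Variable R : realType.
Local Notation C := (R[i] : numClosedFieldType).

Lemma continuous_Re : continuous (@complex.Re R : C -> R).
Proof.
move=> z; apply/(@cvgrPdist_lt _ R _ (nbhs (z : C))) => e e0.
have eC : 0 < e%:C by rewrite ltcR.
near=> w.
rewrite -ltcR; apply: (@le_lt_trans _ _ `|z - w|).
  by rewrite -raddfB; exact: normc_ge_Re.
near: w; apply: (@cvgr_dist_lt _ C _ (nbhs (z:C)) _ id z _ _ eC); exact: cvg_id.
Unshelve. all: by end_near. Qed.

Lemma continuous_Im : continuous (@complex.Im R : C -> R).
Proof.
move=> z.
have -> : (@complex.Im R : C -> R) = (fun w : C => complex.Re (- 'i * w)).
  by apply/funext => -[x y]; simpc.
apply: (@cvg_comp _ _ _ (fun w : C => - 'i * w : C) (@complex.Re R) (nbhs (z : C))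
  (nbhs (- 'i * z : C))); last exact: continuous_Re.
apply: (@cvgMl_tmp C _ (nbhs (z : C)) _ id (- 'i) z); exact: cvg_id.
Qed.

Lemma continuous_real_complex : continuous (fun x : R => x%:C : C).
Proof.
move=> x; apply/(@cvgrPdist_lt _ C _ (nbhs x)) => e e0.
have er : e = (complex.Re e)%:C by rewrite RRe_real// gtr0_real.
have re0 : 0 < complex.Re e by rewrite -ltcR -er.
near=> y.
rewrite er -raddfB normc_def/= expr0n/= addr0 sqrtr_sqr ltcR.
near: y; apply: (@cvgr_dist_lt _ R _ (nbhs x) _ id x _ _ re0); exact: cvg_id.
Unshelve. all: by end_near. Qed.

(* [R[i]] gets its topology only through the cast to [numClosedFieldType]; the
   wrappers keep unification away from it when working with the algebra of [R[i]]. *)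
Variant ccvg T (F : set_system T) (h : T -> R[i]) (c : R[i]) : Prop :=
  CCvg of (h : T -> C) @ F --> (c : C).

Variant ccontinuous (h : R -> R[i]) : Prop :=
  CContinuous of forall t, ccvg (nbhs t) h (h t).

Section ccvg.
Variables (T : Type) (F : set_system T).
Hypothesis FF : Filter F.
Implicit Types (h k : T -> R[i]) (u v : T -> R).

Lemma ccvg_cst (c : R[i]) : ccvg F (fun=> c) c.
Proof. by split; exact: (@cvg_cst C). Qed.

Lemma ccvgD h k a b : ccvg F h a -> ccvg F k b ->
  ccvg F (fun x => h x + k x) (a + b).
Proof.
case=> ha [kb]; split.
have H : ((fun x => @GRing.add C (h x) (k x)) : T -> C) @ F --> (@GRing.add C a b : C).
  exact: (@cvgD _ C T F _ h k a b ha kb).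
exact H.
Qed.

Lemma ccvgN h a : ccvg F h a -> ccvg F (fun x => - h x) (- a).
Proof.
case=> ha; split.
have H : ((fun x => @GRing.opp C (h x)) : T -> C) @ F --> (@GRing.opp C a : C).
  exact: (@cvgN _ C T F _ h a ha).
exact H.
Qed.

Lemma ccvgB h k a b : ccvg F h a -> ccvg F k b ->
  ccvg F (fun x => h x - k x) (a - b).
Proof. by move=> ha kb; apply: ccvgD => //; exact: ccvgN. Qed.

Lemma ccvgM h k a b : ccvg F h a -> ccvg F k b ->
  ccvg F (fun x => h x * k x) (a * b).
Proof. by case=> ha [kb]; split; exact: (@cvgM C T F _ h k a b ha kb). Qed.

Lemma ccvgV h a : a != 0 -> ccvg F h a -> ccvg F (fun x => (h x)^-1) a^-1.
Proof. by move=> a0 [ha]; split; exact: (@cvgV C T F _ h a a0 ha). Qed.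

Lemma ccvg_real_complex u (a : R) : u @ F --> a -> ccvg F (fun x => (u x)%:C) a%:C.
Proof.
move=> ua; split; apply: (@cvg_comp _ _ _ u (fun y => y%:C : C) F (nbhs a)
  (nbhs (a%:C : C)) ua); exact: continuous_real_complex.
Qed.

Lemma ccvg_Re h c : ccvg F h c -> (fun x => complex.Re (h x)) @ F --> complex.Re c.
Proof.
move=> [hc]; apply: (@cvg_comp _ _ _ h (@complex.Re R) F (nbhs (c : C)) _ hc).
exact: continuous_Re.
Qed.

Lemma ccvg_Im h c : ccvg F h c -> (fun x => complex.Im (h x)) @ F --> complex.Im c.
Proof.
move=> [hc]; apply: (@cvg_comp _ _ _ h (@complex.Im R) F (nbhs (c : C)) _ hc).
exact: continuous_Im.
Qed.

Lemma ccvg_complex u v (a b : R) :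
  u @ F --> a -> v @ F --> b -> ccvg F (fun x => u x +i* v x) (a +i* b).
Proof.
move=> ua vb.
have E (x y : R) : x +i* y = x%:C + 'i * y%:C by simpc.
rewrite E; under eq_fun do rewrite E.
apply: ccvgD; first exact: ccvg_real_complex.
by apply: ccvgM; [exact: ccvg_cst|exact: ccvg_real_complex].
Qed.

Lemma ccvg_expi u (a : R) : u @ F --> a -> ccvg F (fun x => expi (u x)) (expi a).
Proof.
move=> ua; apply: ccvg_complex.
  apply: (cvg_comp _ _ ua); exact: continuous_cos.
apply: (cvg_comp _ _ ua); exact: continuous_sin.
Qed.

Lemma ccvg_cexp h c : ccvg F h c -> ccvg F (fun x => cexp (h x)) (cexp c).
Proof.
move=> hc; apply: ccvgM; last by apply: ccvg_expi; exact: ccvg_Im.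
apply: ccvg_real_complex.
apply: (@cvg_comp _ _ _ _ expR F _ _ (ccvg_Re hc)); exact: continuous_expR.
Qed.

End ccvg.

Section ccontinuous.
Implicit Types (h k : R -> R[i]).

Lemma ccts_cst (c : R[i]) : ccontinuous (fun=> c).
Proof. by split=> t; exact: ccvg_cst. Qed.

Lemma cctsD h k : ccontinuous h -> ccontinuous k ->
  ccontinuous (fun t => h t + k t).
Proof. by move=> [ch] [ck]; split=> t; apply: ccvgD; [exact: ch|exact: ck]. Qed.

Lemma cctsM h k : ccontinuous h -> ccontinuous k ->
  ccontinuous (fun t => h t * k t).
Proof. by move=> [ch] [ck]; split=> t; apply: ccvgM; [exact: ch|exact: ck]. Qed.

Lemma cctsZ (c : R[i]) h : ccontinuous h -> ccontinuous (fun t => c * h t).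
Proof. by move=> ch; apply: cctsM => //; exact: ccts_cst. Qed.

Lemma cctsN h : ccontinuous h -> ccontinuous (fun t => - h t).
Proof. by move=> [ch]; split=> t; apply: ccvgN; exact: ch. Qed.

Lemma cctsV h : ccontinuous h -> (forall t, h t != 0) ->
  ccontinuous (fun t => (h t)^-1).
Proof. by move=> [ch] h0; split=> t; apply: ccvgV; [exact: h0|exact: ch]. Qed.

Lemma cctsX h n : ccontinuous h -> ccontinuous (fun t => h t ^+ n).
Proof.
move=> ch; elim: n => [|n IH]; first exact: ccts_cst.
have -> : (fun t => h t ^+ n.+1) = (fun t => h t * h t ^+ n).
  by apply/funext => t; rewrite exprS.
exact: (cctsM ch IH).
Qed.

Lemma ccts_expi : ccontinuous (@expi R).
Proof. by split=> t; apply: ccvg_expi; exact: cvg_id. Qed.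

Lemma ccts_Re h : ccontinuous h -> continuous (fun t => complex.Re (h t)).
Proof. by move=> [ch] t; apply: ccvg_Re; exact: ch. Qed.

Lemma ccts_Im h : ccontinuous h -> continuous (fun t => complex.Im (h t)).
Proof. by move=> [ch] t; apply: ccvg_Im; exact: ch. Qed.

End ccontinuous.

(** * Integrals of continuous complex-valued functions *)

Section cintegral.
Local Notation mu := (@lebesgue_measure R).
Implicit Types (h k : R -> R[i]) (a b : R).

Lemma eq_cintegral h k (D : set R) : h =1 k -> cintegral D h = cintegral D k.
Proof. by move=> /funext ->. Qed.

Lemma cintegralD h k a b : ccontinuous h -> ccontinuous k ->
  cintegral `[a, b] (fun t => h t + k t) = cintegral `[a, b] h + cintegral `[a, b] k.
Proof.
move=> ch ck; rewrite /cintegral.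
have eR : (fun t => complex.Re (h t + k t)) =
    (fun t => complex.Re (h t) + complex.Re (k t)).
  by apply/funext => t; exact: raddfD.
have eI : (fun t => complex.Im (h t + k t)) =
    (fun t => complex.Im (h t) + complex.Im (k t)).
  by apply/funext => t; exact: raddfD.
rewrite eR eI.
rewrite (ctsRintegralD a b (ccts_Re ch) (ccts_Re ck)).
rewrite (ctsRintegralD a b (ccts_Im ch) (ccts_Im ck)).
by rewrite !raddfD/= !mulrDr addrACA.
Qed.

Lemma cintegralZ (c : R[i]) h a b : ccontinuous h ->
  cintegral `[a, b] (fun t => c * h t) = c * cintegral `[a, b] h.
Proof.
move=> ch; have cR := ccts_Re ch; have cI := ccts_Im ch.
have kR (k : R) : continuous (fun t => k * complex.Re (h t)).
  by move=> t; apply: (@cvgMl_tmp R); exact: cR.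
have kI (k : R) : continuous (fun t => k * complex.Im (h t)).
  by move=> t; apply: (@cvgMl_tmp R); exact: cI.
have eR : (fun t => complex.Re (c * h t)) = (fun t =>
    complex.Re c * complex.Re (h t) + - complex.Im c * complex.Im (h t)).
  by apply/funext => t; case: (c) (h t) => ? ? [? ?] /=; ring.
have eI : (fun t => complex.Im (c * h t)) = (fun t =>
    complex.Re c * complex.Im (h t) + complex.Im c * complex.Re (h t)).
  by apply/funext => t; case: (c) (h t) => ? ? [? ?] /=; ring.
rewrite /cintegral eR eI.
rewrite (ctsRintegralD a b (kR _) (kI _)) (ctsRintegralD a b (kI _) (kR _)).
rewrite !(ctsRintegralZ _ a b cR) !(ctsRintegralZ _ a b cI).
by case: (c) => x y; simpc; congr (_ +i* _); ring.
Qed.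

Lemma cintegral_conj h a b : ccontinuous h ->
  cintegral `[a, b] (fun t => (h t)^*) = (cintegral `[a, b] h)^*.
Proof.
move=> ch; rewrite /cintegral.
have eR : (fun t => complex.Re (h t)^*) = (fun t => complex.Re (h t)).
  by apply/funext => t; case: (h t).
have eI : (fun t => complex.Im (h t)^*) = (fun t => -1 * complex.Im (h t)).
  by apply/funext => t; case: (h t) => ? ?; rewrite /= mulN1r.
by rewrite eR eI (ctsRintegralZ _ a b (ccts_Im ch)) mulN1r; simpc.
Qed.

Lemma cintegral_cst (c : R[i]) a b : a <= b ->
  cintegral `[a, b] (fun=> c) = c * (b - a)%:C.
Proof.
move=> ab; rewrite /cintegral !Rintegral_cst_itv//.
by case: c => x y; simpc.
Qed.

Lemma Re_cintegral (D : set R) h :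
  complex.Re (cintegral D h) = \int[mu]_(t in D) complex.Re (h t).
Proof. by rewrite /cintegral; simpc. Qed.

(** Real and imaginary part are each bounded by [M * (b - a)], hence the doubling. This crude
    constant is harmless where it meets a factor [b ^+ m] tending to 0. *)
Lemma norm_cintegral_le h (M : R) a b : ccontinuous h -> a <= b ->
  (forall t, `|h t| <= M%:C) -> `|cintegral `[a, b] h| <= (M * (b - a) *+ 2)%:C.
Proof.
move=> ch ab hM.
have bnd (u : R -> R) : continuous u -> (forall t, `|u t| <= M) ->
    `|\int[mu]_(t in `[a, b]) u t| <= M * (b - a).
  move=> cu uM; rewrite -Rintegral_cst_itv//.
  apply: le_trans (le_normr_Rintegral _ (cts_integrable _ _ cu)) _ => //.
  apply: cts_le_Rintegral => // x; last exact: cvg_cst.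
  by apply: cvg_norm; exact: cu.
have hR t : `|complex.Re (h t)| <= M.
  by rewrite -lecR; apply: le_trans (hM t); exact: normc_ge_Re.
have hI t : `|complex.Im (h t)| <= M.
  rewrite -lecR; apply: le_trans (hM t); rewrite normc_def lecR -sqrtr_sqr.
  by rewrite ler_wsqrtr// lerDr sqr_ge0.
apply: le_trans (ler_normD _ _) _; rewrite raddfMn/= mulr2n lerD//.
  rewrite normc_def/= expr0n/= addr0 sqrtr_sqr lecR bnd//; exact: ccts_Re.
rewrite normrM (_ : `|'i| = 1) ?mul1r; last first.
  by rewrite normc_def/= expr0n/= add0r expr1n sqrtr1.
rewrite normc_def/= expr0n/= addr0 sqrtr_sqr lecR bnd//; exact: ccts_Im.
Qed.

End cintegral.
End Cts.

(** * Integrals against the Schwarz kernel *)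

Section SchwarzKernel.
Local Open Scope classical_set_scope.
Local Open Scope ring_scope.
Local Open Scope complex_scope.
Import ComplexField.Normc.
Variable R : realType.
Local Notation mu := (@lebesgue_measure R).
Implicit Types (h k : R -> R[i]) (s : R).

Lemma normc_ge0 (x : R[i]) : 0 <= normc x.
Proof. by case: x => a b; exact: sqrtr_ge0. Qed.

Lemma conjcD (x y : R[i]) : (x + y)^*%C = x^*%C + y^*%C.
Proof. exact: rmorphD. Qed.

Lemma conjcB (x y : R[i]) : (x - y)^*%C = x^*%C - y^*%C.
Proof. exact: rmorphB. Qed.

Lemma conjcM (x y : R[i]) : (x * y)^*%C = x^*%C * y^*%C.
Proof. exact: rmorphM. Qed.

Lemma ccts_pole (b : R[i]) : `|b| < 1 ->
  ccontinuous (fun t => (expi t - b)^-1).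
Proof.
move=> b1; apply: cctsV => [|t]; last exact: expi_sub_neq0.
by apply: cctsD; [exact: ccts_expi|exact: ccts_cst].
Qed.

Lemma ccts_expiVn n : ccontinuous (fun t : R => (expi t)^-1 ^+ n).
Proof.
by apply/cctsX/cctsV; [exact: ccts_expi|exact: expi_neq0].
Qed.

Lemma period_lt s : s < s + 2 * pi.
Proof. by rewrite ltrDl mulr_gt0// pi_gt0. Qed.

Lemma cintegral_expi_exp s n : cintegral `[s, s + 2 * pi] (fun t => expi t ^+ n.+1) = 0.
Proof.
have n0 : n.+1%:R != 0 :> R by rewrite pnatr_eq0.
have nD (t : R) : is_derive t 1 (fun t : R => n.+1%:R * t) n.+1%:R.
  by apply: is_derive_eq; rewrite /GRing.scale/= ?(mulr1,mulr0,addr0,add0r).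
have e2 : expi (n.+1%:R * (s + 2 * pi)) = expi (n.+1%:R * s).
  by rewrite -!expiX expi2pi.
rewrite /cintegral.
have -> : (fun t : R => complex.Re (expi t ^+ n.+1)) = (fun t => cos (n.+1%:R * t)).
  by apply/funext => t; rewrite expiX.
have -> : (fun t : R => complex.Im (expi t ^+ n.+1)) = (fun t => sin (n.+1%:R * t)).
  by apply/funext => t; rewrite expiX.
have kc : continuous (fun t : R => n.+1%:R * t).
  by move=> t; apply: (@cvgMl_tmp R); exact: cvg_id.
have -> : \int[mu]_(t in `[s, s + 2 * pi]) cos (n.+1%:R * t) =
    n.+1%:R^-1 * sin (n.+1%:R * (s + 2 * pi)) - n.+1%:R^-1 * sin (n.+1%:R * s).
  apply: (@Rintegral_derive R (fun t => n.+1%:R^-1 * sin (n.+1%:R * t))).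
  - exact: period_lt.
  - by move=> t; apply: (continuous_comp (kc t)); exact: continuous_cos.
  - move=> t; have D1 := @is_derive1_comp _ sin _ t _ _ (is_derive_sin _) (nD t).
    apply: is_derive_eq; rewrite /GRing.scale/= ?(mul0r, addr0, add0r).
    by rewrite mulrCA mulVf// mulr1.
have -> : \int[mu]_(t in `[s, s + 2 * pi]) sin (n.+1%:R * t) =
    - n.+1%:R^-1 * cos (n.+1%:R * (s + 2 * pi)) - - n.+1%:R^-1 * cos (n.+1%:R * s).
  apply: (@Rintegral_derive R (fun t => - n.+1%:R^-1 * cos (n.+1%:R * t))).
  - exact: period_lt.
  - by move=> t; apply: (continuous_comp (kc t)); exact: continuous_sin.
  - move=> t; have D1 := @is_derive1_comp _ cos _ t _ _ (is_derive_cos _) (nD t).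
    apply: is_derive_eq; rewrite /GRing.scale/= ?(mul0r, addr0, add0r).
    by field.
by case: e2 => -> ->; rewrite !subrr; simpc.
Qed.

Lemma cintegral_expiV_exp s n :
  cintegral `[s, s + 2 * pi] (fun t => (expi t)^-1 ^+ n.+1) = 0.
Proof.
have -> : (fun t : R => (expi t)^-1 ^+ n.+1) = (fun t : R => (expi t ^+ n.+1)^*).
  by apply/funext => t; rewrite -conj_expi rmorphXn.
rewrite cintegral_conj ?cintegral_expi_exp ?conjc0//.
by apply: cctsX; exact: ccts_expi.
Qed.

(* [I m := int e^{-imt} / (e^{it} - b)] satisfies [I m = b * I m.+1] and is
   bounded, so [I 0 = b ^+ m * I m] tends to 0. *)
Lemma cintegral_pole s (b : R[i]) : `|b| < 1 ->
  cintegral `[s, s + 2 * pi] (fun t => (expi t - b)^-1) = 0.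
Proof.
move=> b1.
pose I m := cintegral `[s, s + 2 * pi] (fun t : R => (expi t)^-1 ^+ m * (expi t - b)^-1).
have cI m : ccontinuous (fun t : R => (expi t)^-1 ^+ m * (expi t - b)^-1).
  by apply: cctsM; [exact: ccts_expiVn|exact: ccts_pole].
have IS m : I m = b * I m.+1.
  rewrite -[RHS]addr0 -(cintegral_expiV_exp s m) -cintegralZ//.
  rewrite -cintegralD; [|exact: cctsZ|exact: ccts_expiVn].
  apply: eq_cintegral => t; rewrite !exprS.
  have := expi_neq0 t; have := expi_sub_neq0 t b1.
  by move: (expi t) => w wb w0; field; rewrite w0.
have I0 m : I 0 = b ^+ m * I m.
  elim: m => [|m IH]; first by rewrite mul1r.
  by rewrite IH IS mulrA exprSr.
have -> : cintegral `[s, s + 2 * pi] (fun t => (expi t - b)^-1) = I 0.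
  by apply: eq_cintegral => t; rewrite expr0 mul1r.
pose M := (1 - normc b)^-1 * (s + 2 * pi - s) *+ 2.
have nb : normc b < 1 by rewrite -ltcR.
have IM m : `|I m| <= M%:C.
  apply: norm_cintegral_le => //; first exact/ltW/period_lt.
  move=> t; rewrite normrM normrX normfV norm_expi invr1 expr1n mul1r.
  have -> : ((1 - normc b)^-1)%:C = (1 - `|b|)^-1 by rewrite fmorphV rmorphB.
  rewrite normfV lef_pV2 ?posrE ?subr_gt0// ?normr_gt0 ?expi_sub_neq0//.
  by rewrite -(norm_expi t) lerB_dist.
apply: eq0_normc; apply/eqP; rewrite eq_le; apply/andP; split; last first.
  exact: normc_ge0.
have lim0 : (fun m => normc b ^+ m * M) @ \oo --> (0 : R).
  rewrite -[X in _ --> X](mul0r M); apply: (@cvgMr_tmp R).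
  by apply: cvg_expr; rewrite ger0_norm// normc_ge0.
rewrite -(cvg_lim _ lim0)//; apply: limr_ge; first by apply/cvg_ex; exists 0.
apply: nearW => m; rewrite -lecR rmorphM rmorphXn/=.
have -> : (normc (I 0))%:C = `|I 0| by [].
by rewrite (I0 m) normrM normrX ler_wpM2l// exprn_ge0.
Qed.

Lemma cintegral1 s : cintegral `[s, s + 2 * pi] (fun=> 1) = (2 * pi)%:C.
Proof.
by rewrite cintegral_cst ?(ltW (period_lt _))// mul1r; congr _%:C; ring.
Qed.

Lemma ccts1B (a : R[i]) : ccontinuous (fun t : R => 1 - a * expi t).
Proof.
by apply: cctsD; [exact: ccts_cst|exact/cctsN/cctsZ/ccts_expi].
Qed.

Lemma ccts_copole (a : R[i]) : `|a| < 1 ->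
  ccontinuous (fun t => (1 - a * expi t)^-1).
Proof.
by move=> a1; apply: cctsV => [|t]; [exact: ccts1B|exact: oneB_neq0].
Qed.

Lemma expiV_sub t (a : R[i]) : (expi t)^-1 - a = (1 - a * expi t) / expi t.
Proof. by have := expi_neq0 t; move: (expi t) => w w0; field. Qed.

(** On the circle conjugation is inversion, so [1 / (1 - a w)] equals 1 plus [a] times the conjugate
    of [1 / (w - b)], where [b] is the conjugate of [a]; the last term integrates to 0 by
    [cintegral_pole]. *)
Lemma cintegral_copole s (a : R[i]) : `|a| < 1 ->
  cintegral `[s, s + 2 * pi] (fun t => (1 - a * expi t)^-1) = (2 * pi)%:C.
Proof.
move=> a1; have b1 : `|a^*%C| < 1 by rewrite normcJ.
transitivity (cintegral `[s, s + 2 * pi]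
    (fun t => 1 + a * ((expi t - a^*%C)^-1)^*%C)).
  apply: eq_cintegral => t; rewrite conjc_inv conjcB conj_expi conjcK expiV_sub.
  have := expi_neq0 t; have := oneB_neq0 t a1.
  move: (expi t) => w wa w0; field.
  by rewrite wa w0.
have cc : ccontinuous (fun t => ((expi t - a^*%C)^-1)^*%C).
  have -> : (fun t => ((expi t - a^*%C)^-1)^*%C) =
      (fun t => - (expi t * (1 - a * expi t)^-1 * -1)).
    apply/funext => t; rewrite conjc_inv conjcB conj_expi conjcK expiV_sub.
    have := expi_neq0 t; have := oneB_neq0 t a1.
    move: (expi t) => w wa w0; field.
    by rewrite wa w0.
  apply/cctsN/cctsM; last exact: ccts_cst.
  by apply: cctsM; [exact: ccts_expi|exact: ccts_copole].
rewrite cintegralD; [|by exact: ccts_cst|exact: cctsZ].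
rewrite cintegral1 cintegralZ// cintegral_conj; last exact: ccts_pole.
by rewrite cintegral_pole// conjc0 mulr0 addr0.
Qed.

Definition schwarz (w z : R[i]) : R[i] := (w + z) / (w - z).

(** On the circle this is the conjugate of the Schwarz kernel at the conjugate of [a], written so as
    to be analytic in [w] on the closed disc. Its real part there is a Poisson kernel. *)
Definition coschwarz (a w : R[i]) : R[i] := (1 + a * w) / (1 - a * w).

Lemma schwarzE (z : R[i]) t : `|z| < 1 ->
  schwarz (expi t) z = 1 + 2 * z * (expi t - z)^-1.
Proof.
move=> z1; rewrite /schwarz; have := expi_sub_neq0 t z1.
by move: (expi t) => w wz; field.
Qed.

Lemma coschwarzE (a : R[i]) t : `|a| < 1 ->
  coschwarz a (expi t) = (schwarz (expi t) a^*%C)^*%C.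
Proof.
move=> a1; rewrite /schwarz /coschwarz conjcM conjc_inv conjcB conjcD.
rewrite conj_expi conjcK expiV_sub.
have := expi_neq0 t; have := oneB_neq0 t a1.
move: (expi t) => w wa w0; field.
by rewrite wa w0.
Qed.

Section Kernel.
Variables (s : R) (z : R[i]).
Hypothesis z1 : `|z| < 1.
Local Notation J h := (cintegral `[s, s + 2 * pi] (fun t => schwarz (expi t) z * h t)).

Lemma ccts_schwarz : ccontinuous (fun t => schwarz (expi t) z).
Proof.
apply: cctsM; last exact: ccts_pole.
by apply: cctsD; [exact: ccts_expi|exact: ccts_cst].
Qed.

Lemma cintegral_schwarz :
  cintegral `[s, s + 2 * pi] (fun t => schwarz (expi t) z) = (2 * pi)%:C.
Proof.
rewrite (eq_cintegral _ (fun t => schwarzE t z1)).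
rewrite cintegralD; [|by exact: ccts_cst|exact/cctsZ/ccts_pole].
rewrite cintegral1 cintegralZ; last exact: ccts_pole.
by rewrite cintegral_pole// mulr0 addr0.
Qed.

(** For [F] analytic on the closed disc, [J F = 2 pi (2 F(z) - F(0))]; this is the case
    [F(w) = w]. *)
Lemma cintegral_schwarz_expi :
  J (fun t => expi t) = (4 * pi)%:C * z.
Proof.
have e t : schwarz (expi t) z * expi t =
    expi t ^+ 1 + z * (1 + schwarz (expi t) z).
  rewrite /schwarz; have := expi_sub_neq0 t z1.
  by move: (expi t) => w wz; field.
have c1 : ccontinuous (fun t => 1 + schwarz (expi t) z).
  by apply: cctsD; [exact: ccts_cst|exact: ccts_schwarz].
rewrite (eq_cintegral _ e) cintegralD; [|exact/cctsX/ccts_expi|exact: cctsZ].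
rewrite cintegral_expi_exp cintegralZ// cintegralD; first last.
- exact: ccts_schwarz.
- by exact: ccts_cst.
rewrite cintegral1 cintegral_schwarz add0r mulrC -rmorphD/=.
by congr (_%:C * _); ring.
Qed.

(** Conjugate-analytic data contribute only through their value at the origin: [J] of the conjugate
    of [F] is [2 pi] times the conjugate of [F(0)]. Here [F(w) = w], and in the next lemma [F] is
    [coschwarz] at the conjugate of [b]. *)
Lemma cintegral_schwarz_expiV : J (fun t => (expi t)^-1) = 0.
Proof.
have e t : schwarz (expi t) z * (expi t)^-1 =
    (-1) * (expi t)^-1 ^+ 1 + 2 * (expi t - z)^-1.
  rewrite /schwarz; have := expi_sub_neq0 t z1; have := expi_neq0 t.
  by move: (expi t) => w w0 wz; field; rewrite wz w0.
rewrite (eq_cintegral _ e) cintegralD; first last.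
- exact/cctsZ/ccts_pole.
- exact/cctsZ/ccts_expiVn.
rewrite !cintegralZ; [|exact: ccts_pole|exact: ccts_expiVn].
by rewrite cintegral_expiV_exp cintegral_pole// !mulr0 addr0.
Qed.

Lemma cintegral_schwarz_schwarz (b : R[i]) : `|b| < 1 -> z != b ->
  J (fun t => schwarz (expi t) b) = (2 * pi)%:C.
Proof.
move=> b1 zb; have zb0 : z - b != 0 by rewrite subr_eq0.
(* Both poles lie inside the disc; they must be distinct for this decomposition into simple
   fractions, hence [z != b]. *)
have e t : schwarz (expi t) z * schwarz (expi t) b =
    1 + ((2 * z + 4 * z * b / (z - b)) * (expi t - z)^-1 +
    (2 * b - 4 * z * b / (z - b)) * (expi t - b)^-1).
  rewrite /schwarz; have := expi_sub_neq0 t z1; have := expi_sub_neq0 t b1.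
  by move: (expi t) => w wb wz; field; rewrite ?wb ?wz ?zb0 ?az.
have [cz cb] := (ccts_pole z1, ccts_pole b1).
rewrite (eq_cintegral _ e) cintegralD; first last.
- by apply: cctsD; exact: cctsZ.
- by exact: ccts_cst.
rewrite cintegralD; [|exact: cctsZ..].
by rewrite !cintegralZ// !cintegral_pole// !mulr0 cintegral1 !addr0.
Qed.

(** The analytic rule again, with [F = coschwarz a] and [F(0) = 1]. The factors [1 - a w] and
    [w - z] cannot vanish together, so the partial fractions exist for every [z] in the disc. *)
Lemma cintegral_schwarz_coschwarz (a : R[i]) : `|a| < 1 ->
  J (fun t => coschwarz a (expi t)) = (2 * pi)%:C * (2 * coschwarz a z - 1).
Proof.
move=> a1; have az : 1 - a * z != 0.
  rewrite subr_eq0; apply/eqP => h.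
  have : `|a| * `|z| < 1 by rewrite mulr_ilt1.
  by rewrite -normrM -h normr1 ltxx.
have e t : schwarz (expi t) z * coschwarz a (expi t) =
    (-1) + ((2 + 4 * z * a / (1 - a * z)) * (1 - a * expi t)^-1 +
    (4 * z / (1 - a * z) - 2 * z) * (expi t - z)^-1).
  rewrite /schwarz /coschwarz; have := expi_sub_neq0 t z1; have := oneB_neq0 t a1.
  by move: (expi t) => w wb wz; field; rewrite ?wb ?wz ?zb0 ?az.
have [cz ca] := (ccts_pole z1, ccts_copole a1).
rewrite (eq_cintegral _ e) cintegralD; first last.
- by apply: cctsD; exact: cctsZ.
- by exact: ccts_cst.
rewrite cintegralD; [|exact: cctsZ..].
rewrite !cintegralZ// cintegral_pole// mulr0 addr0 cintegral_copole//.
rewrite cintegral_cst ?(ltW (period_lt _))//.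
have -> : s + 2 * pi - s = 2 * pi by ring.
by rewrite /coschwarz; field.
Qed.

End Kernel.
End SchwarzKernel.

(** * Concentration of the densities [exp (K cos t)] at [t = 0] *)

Section Concentration.
Local Open Scope classical_set_scope.
Local Open Scope ring_scope.
Local Open Scope complex_scope.
Variable R : realType.
Local Notation mu := (@lebesgue_measure R).

Lemma cts_expcos (K : R) : continuous (fun t : R => expR (K * cos t)).
Proof.
move=> t; apply: (@continuous_comp _ _ _ (fun t : R => K * cos t)).
  by apply: (@cvgMl_tmp R); exact: continuous_cos.
exact: continuous_expR.
Qed.

Lemma ctsRM (f g : R -> R) : continuous f -> continuous g ->
  continuous (fun t => f t * g t).
Proof. by move=> cf cg t; apply: cvgM; [exact: cf|exact: cg]. Qed.

Lemma ctsRD (f g : R -> R) : continuous f -> continuous g ->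
  continuous (fun t => f t + g t).
Proof. by move=> cf cg t; apply: cvgD; [exact: cf|exact: cg]. Qed.

Lemma ctsR_cst (c : R) : continuous (fun _ : R => c).
Proof. by move=> t; exact: cvg_cst. Qed.

Lemma cos_ltr_norm (x y : R) : `|x| <= pi -> `|y| <= pi ->
  (cos x < cos y) = (`|y| < `|x|).
Proof.
have cos_norm (z : R) : cos z = cos `|z|.
  by case: (ger0P z) => //; rewrite cosN.
move=> xpi ypi; rewrite cos_norm (cos_norm y) ltr_cos//.
by rewrite in_itv/= normr_ge0.
by rewrite in_itv/= normr_ge0.
Qed.

(** Laplace's method: for [|t| < x] continuity gives [u t < e / 2], while the weight on [|t| >= x]
    is at most [exp (K cos x)], exponentially smaller than the weight on [|t| <= x / 2]. *)
Lemma expcos_concentrates (u : R -> R) (B e : R) :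
  continuous u -> (forall t, u t <= B) -> u 0 <= 0 -> 0 < e -> 0 < B ->
  exists2 K : R, 0 <= K &
    \int[mu]_(t in `[- pi, pi]) (expR (K * cos t) * u t) <=
    e * \int[mu]_(t in `[- pi, pi]) expR (K * cos t).
Proof.
move=> cu uB u0 e0 B0.
have pi0 : 0 < pi :> R := pi_gt0 R.
have [d d0 ud] : exists2 d : R, 0 < d & forall t, `|t| < d -> u t < e / 2.
  have e20 : 0 < e / 2 by rewrite divr_gt0.
  have /cvgrPdist_lt/(_ _ e20) := cu 0.
  move=> /nbhs_ballP[d /= d0 hd]; exists d => // t td.
  have : `|u 0 - u t| < e / 2 by apply: hd; rewrite /ball/= sub0r normrN.
  by rewrite ltr_norml => /andP[]; lra.
pose x := Num.min d pi.
have x0 : 0 < x by rewrite lt_min d0.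
have xd : x <= d by rewrite ge_min lexx.
have xpi : x <= pi by rewrite ge_min lexx orbT.
pose y := cos (x / 2) - cos x.
have y0 : 0 < y.
  rewrite subr_gt0 cos_ltr_norm; first by rewrite !gtr0_norm; lra.
    by rewrite gtr0_norm.
  by rewrite gtr0_norm; lra.
(* The outer part is absorbed once [4 pi B <= e x exp (K y)]. Since [exp (K y) >= 1 + K y], it
   suffices that [K y e x = 4 pi B]. *)
pose K := 4 * pi * B / (e * x * y).
have K0 : 0 <= K by rewrite divr_ge0// !mulr_ge0// ltW.
exists K => //.
set I := \int[mu]_(t in `[- pi, pi]) expR (K * cos t).
have IK : x * expR (K * cos (x / 2)) <= I.
  apply: (@le_trans _ _ (\int[mu]_(t in `[- (x / 2), x / 2]) expR (K * cos t))).
    rewrite (_ : x * _ = expR (K * cos (x / 2)) * (x / 2 - - (x / 2))); last by field.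
    rewrite -Rintegral_cst_itv; last lra.
    apply: cts_le_Rintegral; [exact: ctsR_cst|exact: cts_expcos|].
    move=> t; rewrite in_itv/= => /andP[t1 t2].
    rewrite ler_expR ler_wpM2l// leNgt cos_ltr_norm -?leNgt ?(gtr0_norm (x := x / 2)).
    + by rewrite ler_norml; lra.
    + lra.
    + by rewrite ler_norml; lra.
    + lra.
    + lra.
  by apply: cts_le_Rintegral_sub; [exact: cts_expcos|move=> t; exact: expR_ge0|lra|lra].
(* Both terms of the majorant are nonnegative: the first dominates for [|t| < x], the second for
   [|t| >= x], so the integral need not be split. *)
have bnd : \int[mu]_(t in `[- pi, pi]) (expR (K * cos t) * u t) <=
    \int[mu]_(t in `[- pi, pi]) (e / 2 * expR (K * cos t) + B * expR (K * cos x)).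
  have cK := @cts_expcos K.
  apply: cts_le_Rintegral.
  - exact: ctsRM.
  - by apply: ctsRD; [apply: ctsRM => //|]; exact: ctsR_cst.
  move=> t; rewrite in_itv/= -ler_norml => tpi.
  have Kt0 := expR_gt0 (K * cos t); have Kx0 := expR_gt0 (K * cos x).
  have [tx|xt] := ltP `|t| x.
    have /ud ut : `|t| < d by exact: lt_le_trans xd.
    apply: (@le_trans _ _ (e / 2 * expR (K * cos t))).
      by rewrite mulrC ler_pM2r// ltW.
    by rewrite lerDl mulr_ge0// ltW.
  apply: (@le_trans _ _ (B * expR (K * cos x))); last first.
    by rewrite lerDr mulr_ge0// ?divr_ge0// ltW.
  apply: (@le_trans _ _ (B * expR (K * cos t))).
    by rewrite mulrC ler_pM2r.
  rewrite ler_pM2l// ler_expR ler_wpM2l// leNgt cos_ltr_norm -?leNgt// gtr0_norm//.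
apply: (le_trans bnd).
rewrite ctsRintegralD; last 2 first.
- by apply: ctsRM; [exact: ctsR_cst|exact: cts_expcos].
- exact: ctsR_cst.
rewrite ctsRintegralZ; last exact: cts_expcos.
rewrite Rintegral_cst_itv; last lra.
rewrite -/I; suff : B * expR (K * cos x) * (pi - - pi) <= e / 2 * I by lra.
apply: (@le_trans _ _ (e / 2 * (x * expR (K * cos (x / 2))))); last first.
  by rewrite ler_pM2l// divr_gt0.
have -> : K * cos (x / 2) = K * cos x + K * y by rewrite /y; ring.
rewrite expRD; set E := expR (K * cos x); have E0 : 0 < E by exact: expR_gt0.
have Ky : K * y * (e * x) = 4 * pi * B by rewrite /K; field; lra.
have h := expR_ge1Dx (K * y).
have : (1 + K * y) * (e * x) <= expR (K * y) * (e * x).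
  by rewrite ler_wpM2r// mulr_ge0// ltW.
rewrite mulrDl Ky mul1r => h2.
rewrite (_ : _ * (pi - - pi) = (4 * pi * B) / 2 * E); last by field.
rewrite (_ : e / 2 * _ = (expR (K * y) * (e * x)) / 2 * E); last by field.
rewrite ler_pM2r//; have : 0 < e * x by rewrite mulr_gt0.
lra.
Qed.

End Concentration.

(** * Explicit spectral factors and their radial limits *)

Section SpectralFactor.
Local Open Scope classical_set_scope.
Local Open Scope ring_scope.
Local Open Scope complex_scope.
Import ComplexField.Normc.
Variable R : realType.
Local Notation mu := (@lebesgue_measure R).
Implicit Types (a z : R[i]) (h K d t : R).

Definition sqn z : R := complex.Re z ^+ 2 + complex.Im z ^+ 2.

Lemma sqnM z (w : R[i]) : sqn (z * w) = sqn z * sqn w.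
Proof. by case: z w => [x y] [x' y']; rewrite /sqn/=; ring. Qed.

Lemma sqn_cexp z : sqn (cexp z) = expR (2 * complex.Re z).
Proof.
rewrite /sqn /cexp /expi; simpc; rewrite !exprMn -mulrDr cos2Dsin2 mulr1.
by rewrite expr2 -expRD; congr expR; ring.
Qed.

Lemma sqn_cexpB1 z : sqn (cexp z - 1) =
  expR (2 * complex.Re z) - 2 * expR (complex.Re z) * cos (complex.Im z) + 1.
Proof.
rewrite -sqn_cexp /sqn /cexp /expi; simpc; rewrite /=. ring.
Qed.

Lemma cexpD z (w : R[i]) : cexp (z + w) = cexp z * cexp w.
Proof.
by rewrite /cexp !raddfD/= expRD expiD rmorphM/= mulrACA.
Qed.

(** Analytic logarithm of the spectral factors: [d = 0], [a = 0] serves [f^+], and general [d], [a]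
    serve [g^+]. On the circle, twice its real part is [2 h + K cos t] minus [2 d] times a Poisson
    kernel. *)
Definition outer_log h K d a z : R[i] :=
  h%:C + (K / 2)%:C * z - d%:C * coschwarz a z.

Lemma Re_coschwarz a t : `|a| < 1 ->
  complex.Re (schwarz (expi t) a^*%C) = complex.Re (coschwarz a (expi t)).
Proof. by move=> a1; rewrite coschwarzE//; case: (schwarz _ _). Qed.

Lemma ccts_coschwarz a : `|a| < 1 -> ccontinuous (fun t => coschwarz a (expi t)).
Proof.
move=> a1; apply: cctsM; last exact: ccts_copole.
by apply: cctsD; [exact: ccts_cst|exact/cctsZ/ccts_expi].
Qed.

(** Let [F] be [outer_log h K d a]. On the circle [log f] is [F] plus its conjugate, whose Schwarz
    integrals are [2 pi (2 F(z) - F(0))] and [2 pi] times the conjugate of [F(0)]. As [F(0) = h - d]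
    is real, only [4 pi F(z)] survives. The excluded point comes from the product of two Schwarz
    kernels. *)
Lemma spectral_factor_outer (f : R[i] -> R) h K d a z :
  (forall t, ln (f (expi t)) = 2 * complex.Re (outer_log h K d a (expi t))) ->
  `|a| < 1 -> `|z| < 1 -> z != a^*%C ->
  spectral_factor f z = cexp (outer_log h K d a z).
Proof.
move=> lnf a1 z1 za.
have b1 : `|a^*%C| < 1 by rewrite normcJ.
have cz := ccts_schwarz z1.
have e t : (expi t + z) / (expi t - z) * (ln (f (expi t)))%:C =
    (2 * h)%:C * schwarz (expi t) z +
    ((K / 2)%:C * (schwarz (expi t) z * expi t + schwarz (expi t) z * (expi t)^-1) +
    (- d)%:C * (schwarz (expi t) z * coschwarz a (expi t) +
      schwarz (expi t) z * schwarz (expi t) a^*%C)).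
  have Re2 (x : R[i]) : (2 * complex.Re x)%:C = x + x^*%C.
    by case: x => x y; apply/eqP; rewrite eq_complex/=; apply/andP; split; apply/eqP; ring.
  have Ecos : coschwarz a (expi t) + schwarz (expi t) a^*%C =
      (2 * complex.Re (coschwarz a (expi t)))%:C.
    by rewrite Re2 coschwarzE// conjcK.
  have Eexp : expi t + (expi t)^-1 = (2 * cos t)%:C.
    rewrite -conj_expi; apply/eqP; rewrite eq_complex/=.
    by apply/andP; split; apply/eqP; ring.
  rewrite -/(schwarz (expi t) z) -!mulrDr Ecos Eexp lnf /outer_log.
  have -> : complex.Re (h%:C + (K / 2)%:C * expi t - d%:C * coschwarz a (expi t)) =
      h + K / 2 * cos t - d * complex.Re (coschwarz a (expi t)).
    by case: (coschwarz _ _) => x y; rewrite /expi; simpc.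
  by rewrite !(rmorphM, rmorphD, rmorphN, rmorphB)/=; ring.
(* This puts the domain in the form [[s, s + 2 * pi]] with [s = 0]. *)
rewrite /spectral_factor (eq_cintegral _ e) -[2 * pi]add0r.
have c1 := cctsM cz (@ccts_expi R).
have c2 : ccontinuous (fun t => schwarz (expi t) z * (expi t)^-1).
  by apply: cctsM => //; apply: cctsV; [exact: ccts_expi|exact: expi_neq0].
have c3 := cctsM cz (ccts_coschwarz a1).
have c4 := cctsM cz (ccts_schwarz b1).
have c12 := cctsD c1 c2; have c34 := cctsD c3 c4.
rewrite (cintegralD _ _ (cctsZ _ cz) (cctsD (cctsZ _ c12) (cctsZ _ c34))).
rewrite (cintegralD _ _ (cctsZ _ c12) (cctsZ _ c34)).
rewrite (cintegralZ _ _ _ cz) (cintegralZ _ _ _ c12) (cintegralZ _ _ _ c34).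
rewrite (cintegralD _ _ c1 c2) (cintegralD _ _ c3 c4).
rewrite cintegral_schwarz// cintegral_schwarz_expi// cintegral_schwarz_expiV//.
rewrite cintegral_schwarz_coschwarz// cintegral_schwarz_schwarz//.
congr cexp; rewrite /outer_log !(rmorphM, rmorphN, fmorphV)/=.
have p0 : (pi : R)%:C != 0 by rewrite fmorph_eq0 gt_eqF ?pi_gt0.
have -> : (2 : R)%:C = 2 by rewrite rmorph_nat.
have -> : (4 : R)%:C = 4 by rewrite rmorph_nat.
by move: (pi%:C) p0 => p p0; field.
Qed.

Lemma ccvg_outer h K d a t : `|a| < 1 ->
  ccvg (1:R)^'- (fun r => cexp (outer_log h K d a (r%:C * expi t)))
    (cexp (outer_log h K d a (expi t))).
Proof.
move=> a1.
have cr : ccvg (1:R)^'- (fun r => r%:C * expi t) (expi t).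
  rewrite -[X in ccvg _ _ X]mul1r; apply: ccvgM; last exact: ccvg_cst.
  by apply: ccvg_real_complex; apply: cvg_at_left_filter; exact: cvg_id.
apply: ccvg_cexp; apply: ccvgB; last first.
  apply: ccvgM; first exact: ccvg_cst.
  apply: ccvgM.
    by apply: ccvgD; [exact: ccvg_cst|apply: ccvgM => //; exact: ccvg_cst].
  apply: ccvgV; first exact: oneB_neq0.
  by apply: ccvgB; [exact: ccvg_cst|apply: ccvgM => //; exact: ccvg_cst].
by apply: ccvgD; [exact: ccvg_cst|apply: ccvgM => //; exact: ccvg_cst].
Qed.

(** Agreement near the end of the radius is enough, which accommodates a formula for [F] that leaves
    out a point of the disc. *)
Lemma boundary_ccvg (F G : R[i] -> R[i]) t (l : R[i]) :
  (\forall r \near (1:R)^'-, F (r%:C * expi t) = G (r%:C * expi t)) ->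
  ccvg (1:R)^'- (fun r => G (r%:C * expi t)) l -> boundary F t = l.
Proof.
move=> FG [Gl]; apply: (@cvg_lim (R[i] : numClosedFieldType)).
  exact: (@norm_hausdorff _ (R[i] : numClosedFieldType)).
by apply: cvg_trans Gl; apply: near_eq_cvg; near do apply: esym.
Unshelve. all: by end_near. Qed.

(** Every radius [r] with [|a| < r < 1] qualifies, the excluded point having modulus [|a|]. *)
Lemma near_radius a t : `|a| < 1 ->
  \forall r \near (1:R)^'-, `|r%:C * expi t| < 1 /\ r%:C * expi t != a^*%C.
Proof.
move=> a1; have na1 : normc a < 1 by rewrite -ltcR.
near=> r.
have ar : normc a < r by near: r; exact: nbhs_left_gt.
have r1 : r < 1 by near: r; exact: nbhs_left_lt.
have r0 : 0 < r by apply: le_lt_trans ar; exact: normc_ge0.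
have nr : `|r%:C * expi t| = r%:C by rewrite normrM norm_expi mulr1 ger0_norm// ler0c ltW.
rewrite nr ltcR; split => //; apply/eqP => e0.
have : `|a| = r%:C by rewrite -nr e0 normcJ.
by move=> /(@complexI R) e; move: ar; rewrite e ltxx.
Unshelve. all: by end_near. Qed.

Lemma boundary_outer (f g : R[i] -> R) h K d a t : `|a| < 1 ->
  (forall t, ln (f (expi t)) = 2 * complex.Re (outer_log h K 0 0 (expi t))) ->
  (forall t, ln (g (expi t)) = 2 * complex.Re (outer_log h K d a (expi t))) ->
  boundary (fun z => spectral_factor g z - spectral_factor f z) t =
  cexp (outer_log h K d a (expi t)) - cexp (outer_log h K 0 0 (expi t)).
Proof.
move=> a1 lnf lng; have z1 : `|0 : R[i]| < 1 by rewrite normr0.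
apply: (@boundary_ccvg _ (fun z =>
  cexp (outer_log h K d a z) - cexp (outer_log h K 0 0 z))); last first.
  by apply: ccvgB; exact: ccvg_outer.
have n1 := near_radius t a1; have n0 := near_radius t z1.
near=> r.
have [r1 ra] : `|r%:C * expi t| < 1 /\ r%:C * expi t != a^*%C by near: r.
have [_ r0] : `|r%:C * expi t| < 1 /\ r%:C * expi t != 0^*%C by near: r.
by rewrite (spectral_factor_outer lng)// (spectral_factor_outer lnf).
Unshelve. all: by end_near. Qed.

End SpectralFactor.

(** * The Poisson perturbation and the pair [f], [g] for a given [x] *)

Section Pair.
Local Open Scope classical_set_scope.
Local Open Scope ring_scope.
Local Open Scope complex_scope.
Variable R : realType.
Local Notation mu := (@lebesgue_measure R).

(** With [v = 1 - a e^{it}] the function is [2 / v - 1], and [|1 - v| < 1] says [|v|^2 < 2 Re v],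
    that is [Re (1 / v) > 1 / 2]. *)
Lemma Re_coschwarz_ge0 (a : R[i]) t : `|a| < 1 ->
  0 <= complex.Re (coschwarz a (expi t)).
Proof.
move=> a1; have v0 := oneB_neq0 t a1.
have : `|a * expi t| < 1 by rewrite normrM norm_expi mulr1.
have -> : coschwarz a (expi t) = (2 - (1 - a * expi t)) / (1 - a * expi t).
  by rewrite /coschwarz; congr (_ / _); ring.
have -> : `|a * expi t| = `|1 - (1 - a * expi t)| by congr `|_|; ring.
move: (1 - a * expi t) v0 => v v0; rewrite mulrBl divff//.
have n0 : complex.Re v ^+ 2 + complex.Im v ^+ 2 != 0.
  apply: contra v0 => /eqP; case: v => x y /= e.
  have /andP[/eqP-> /eqP->] : (x == 0) && (y == 0).
    by move/eqP: e; rewrite paddr_eq0 ?sqr_ge0// !sqrf_eq0.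
  by [].
case: v v0 n0 => x y v0 /= n0.
have nn : 0 < x ^+ 2 + y ^+ 2 by rewrite lt_neqAle eq_sym n0 addr_ge0 ?sqr_ge0.
rewrite normc_def/= ltcR -[ltRHS]sqrtr1 ltr_sqrt// => h.
rewrite subr_ge0 (_ : _ - _ = (2 * x) / (x ^+ 2 + y ^+ 2)); last by ring.
rewrite ler_pdivlMr// mul1r.
by move: h; rewrite !expr2; lra.
Qed.

Lemma Rintegral_Re_coschwarz (a : R[i]) : `|a| < 1 ->
  \int[mu]_(t in `[- pi, pi]) complex.Re (coschwarz a (expi t)) = 2 * pi.
Proof.
move=> a1; have b1 : `|a^*%C| < 1 by rewrite normcJ.
have -> : (fun t => complex.Re (coschwarz a (expi t))) =
    (fun t => complex.Re (schwarz (expi t) a^*%C)).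
  by apply/funext => t; rewrite Re_coschwarz.
(* The domain becomes a period starting at [s = - pi]; the substitution also hits the lower end,
   which the next line restores. *)
rewrite -Re_cintegral (_ : pi = - pi + 2 * pi :> R); last by ring.
rewrite (_ : - (- pi + 2 * pi) = - pi :> R); last by ring.
by rewrite cintegral_schwarz//=; ring.
Qed.

(** The Cayley transform [(s - 1) / (s + 1)] maps the right half-plane into the disc and inverts
    [(1 + a) / (1 - a)]. So the value at 1 may have an imaginary part as large as desired, although
    the mean of the real part stays 1. *)
Lemma cayley (s : R[i]) : 0 < complex.Re s ->
  exists2 a : R[i], `|a| < 1 & coschwarz a 1 = s.
Proof.
move=> s0; have s1 : s + 1 != 0.
  by apply/eqP => e; move: (congr1 (@complex.Re R) e); rewrite raddfD/=; lra.
exists ((s - 1) / (s + 1)).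
  rewrite normf_div ltr_pdivrMr ?normr_gt0// mul1r !normc_def ltcR.
  have n0 : 0 < complex.Re (s + 1) ^+ 2 + complex.Im (s + 1) ^+ 2.
    by rewrite ltr_pwDl ?sqr_ge0// exprn_gt0// raddfD/=; lra.
  rewrite ltr_sqrt//; case: s s0 {s1 n0} => x y /= x0.
  by rewrite !expr2; lra.
rewrite /coschwarz !mulr1.
have -> : 1 + (s - 1) / (s + 1) = (2 * s) / (s + 1) by field.
have -> : 1 - (s - 1) / (s + 1) = 2 / (s + 1) by field.
by field; rewrite s1.
Qed.

Lemma far_spectral_factors (x : R) : 0 < x -> x <= 1 ->
  exists fg : (R[i] -> R) * (R[i] -> R),
      [/\ (forall t : R, 0 <= fg.1 (expi t)) /\ (forall t : R, 0 <= fg.2 (expi t)),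
          L1T fg.1 /\ L1T fg.2,
          logL1T fg.1 /\ logL1T fg.2,
          [/\ normL1 fg.1 <= 1, normL1 fg.2 <= 1,
              normL1 (fun z => fg.2 z - fg.1 z) <= x &
              normL1 (fun z => ln (fg.2 z) - ln (fg.1 z)) <= x] &
          normH2 (fun z => spectral_factor fg.2 z - spectral_factor fg.1 z)
            >= 2 - x].
Proof.
move=> x0 x1; have pi0 : 0 < pi :> R := pi_gt0 R.
(* [||log g - log f|| = 4 pi d] and [w 0 = - (q + i pi)], so that [g^+ / f^+] is
   [- exp (- q)] at the point where [f] concentrates. *)
pose q := x / 4; pose d := x / (4 * pi).
have q0 : 0 < q by rewrite divr_gt0.
have d0 : 0 < d by rewrite divr_gt0// mulr_gt0.
have [a a1 as_] : exists2 a : R[i], `|a| < 1 & coschwarz a 1 = (q / d) +i* (pi / d).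
  by apply: cayley; rewrite divr_gt0.
pose r t := complex.Re (coschwarz a (expi t)).
pose p t := - (d * r t).
pose w t := - (d%:C * coschwarz a (expi t)).
have Rew t : complex.Re (w t) = p t.
  by rewrite /w /p /r; case: (coschwarz _ _) => u v; simpc.
have p_le0 t : p t <= 0.
  by rewrite oppr_le0 mulr_ge0 ?(ltW d0)//; exact: Re_coschwarz_ge0.
have w0 : w 0 = (- q) +i* (- pi).
  have scale (u v y : R) : - (u%:C * (v +i* y)) = (- (u * v)) +i* (- (u * y)).
    by simpc.
  have dn0 : d != 0 by rewrite gt_eqF.
  by rewrite /w expi0 as_ scale !(mulrCA d) divff// !mulr1.
have p0 : p 0 = - q by rewrite -Rew w0.
have cr : continuous r by apply: ccts_Re; exact: ccts_coschwarz.
have cw : ccontinuous w by apply/cctsN/cctsZ; exact: ccts_coschwarz.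
have cp : continuous p.
  by move=> t; apply: (@cvgN _ R); apply: (@cvgMl_tmp R); exact: cr.
have c2p : continuous (fun t => expR (2 * p t)).
  move=> t; apply: (@continuous_comp _ _ _ (fun t => 2 * p t)).
    by apply: (@cvgMl_tmp R); exact: cp.
  exact: continuous_expR.
(* Densities relative to [f]: [|g - f| = f F1] and [|g^+ - f^+|^2 = f F2] on the circle. *)
pose F1 t := 1 - expR (2 * p t).
pose F2 t := sqn (cexp (w t) - 1).
have cF1 : continuous F1.
  by move=> t; apply: (@cvgB _ R); [exact: cvg_cst|exact: c2p].
have cew : ccontinuous (fun t => cexp (w t) - 1).
  by split=> t; apply: ccvgB; [apply: ccvg_cexp; case: cw|exact: ccvg_cst].
have cF2 : continuous F2.
  have [cR cI] := (ccts_Re cew, ccts_Im cew).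
  have -> : F2 = (fun t =>
      complex.Re (cexp (w t) - 1) * complex.Re (cexp (w t) - 1) +
      complex.Im (cexp (w t) - 1) * complex.Im (cexp (w t) - 1)).
    by apply/funext => t; rewrite /F2 /sqn !expr2.
  by apply: ctsRD; exact: ctsRM.
have F1_ge0 t : 0 <= F1 t.
  by rewrite subr_ge0 -[leRHS]expR0 ler_expR; have := p_le0 t; clear; lra.
have F1_le1 t : F1 t <= 1 by rewrite /F1; have := expR_gt0 (2 * p t); lra.
have F2_ge0 t : 0 <= F2 t by rewrite addr_ge0 ?sqr_ge0.
have F2_le4 t : F2 t <= 4.
  rewrite /F2 sqn_cexpB1 Rew.
  have e2 : expR (2 * p t) = expR (p t) * expR (p t).
    by rewrite -expRD; congr expR; ring.
  have e0 := expR_gt0 (p t).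
  have e1 : expR (p t) <= 1 by rewrite -[leRHS]expR0 ler_expR.
  have := cos_geN1 (complex.Im (w t)); rewrite e2.
  by move: (expR (p t)) (cos _) e0 e1 => y z *; nra.
(* A single function dominating both deviations from [t = 0], so that one [K] serves both norms. *)
pose U t := `|F1 t - F1 0| + `|F2 t - F2 0|.
have cU : continuous U.
  by apply: ctsRD => t; apply: cvg_norm; apply: (@cvgB _ R);
    [exact: cF1|exact: cvg_cst|exact: cF2|exact: cvg_cst].
have U_le t : U t <= 10.
  have := (F1_ge0 t, F1_ge0 0, F1_le1 t, F1_le1 0) => -[[[? ?] ?] ?].
  have := (F2_ge0 t, F2_ge0 0, F2_le4 t, F2_le4 0) => -[[[? ?] ?] ?].
  have : `|F1 t - F1 0| <= 2 by rewrite ler_norml; lra.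
  have : `|F2 t - F2 0| <= 8 by rewrite ler_norml; lra.
  by rewrite /U; clear; lra.
have U0 : U 0 <= 0 by rewrite /U !subrr normr0 addr0.
(* Of the allowance [x] for [g - f], one half goes to [F1 0] and the other to the average of [U]. *)
have x20 : 0 < x / 2 by rewrite divr_gt0.
have [K K0 hK] := expcos_concentrates cU U_le U0 x20 (ltr0n R 10).
pose ek t := expR (K * cos t).
have cek : continuous ek by exact: cts_expcos.
pose I := \int[mu]_(t in `[- pi, pi]) ek t.
have I0 : 0 < I.
  apply: (@lt_le_trans _ _ (expR (- K) * (pi - - pi))).
    by rewrite mulr_gt0 ?expR_gt0//; lra.
  rewrite -Rintegral_cst_itv; last lra.
  apply: cts_le_Rintegral => // [|t _]; first exact: ctsR_cst.
  by rewrite ler_expR; have := cos_geN1 t; nra.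
pose c := I^-1.
have c0 : 0 < c by rewrite invr_gt0.
pose f (z : R[i]) := c * expR (K * complex.Re z).
pose g (z : R[i]) := f z * expR (2 * complex.Re (- (d%:C * coschwarz a z))).
have fE t : f (expi t) = c * ek t by [].
have gE t : g (expi t) = c * ek t * expR (2 * p t) by rewrite /g fE -Rew.
have f_gt0 t : 0 < f (expi t) by rewrite fE mulr_gt0 ?expR_gt0.
have g_gt0 t : 0 < g (expi t) by rewrite gE mulr_gt0 ?expR_gt0 // mulr_gt0 ?expR_gt0.
have lnf t : ln (f (expi t)) = ln c + K * cos t.
  by rewrite fE lnM ?posrE ?expR_gt0// expRK.
have lng t : ln (g (expi t)) = ln c + K * cos t + 2 * p t.
  by rewrite gE -fE lnM ?posrE ?expR_gt0// expRK lnf.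
have cf : continuous (fun t => f (expi t)).
  by apply: ctsRM => //; exact: ctsR_cst.
have cg : continuous (fun t => g (expi t)).
  rewrite (_ : (fun t => g (expi t)) = (fun t => f (expi t) * expR (2 * p t))).
    exact: ctsRM.
  by apply/funext => t; rewrite gE fE.
have clnf : continuous (fun t => ln (f (expi t))).
  rewrite (funext lnf); apply: ctsRD; first exact: ctsR_cst.
  by apply: ctsRM; [exact: ctsR_cst|exact: continuous_cos].
have clng : continuous (fun t => ln (g (expi t))).
  rewrite (_ : (fun t => ln (g (expi t))) = (fun t => ln (f (expi t)) + 2 * p t)).
    by apply: ctsRD => //; apply: ctsRM => //; exact: ctsR_cst.
  by apply/funext => t; rewrite lng lnf.
have nf : normL1 f = 1.
  rewrite /normL1 (_ : (fun t => _) = (fun t => c * ek t)); last first.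
    by apply/funext => t; rewrite ger0_norm ?(ltW (f_gt0 t)).
  by rewrite ctsRintegralZ// mulVf// gt_eqF.
(* From here on [c * ek t] acts as a probability density, and the [avg] facts are the rules of
   expectation. *)
have avg (F : R -> R) : continuous F ->
    \int[mu]_(t in `[- pi, pi]) (c * ek t * F t) =
    c * \int[mu]_(t in `[- pi, pi]) (ek t * F t).
  move=> cF; rewrite -ctsRintegralZ; last exact: ctsRM.
  by congr (Rintegral _ _ _); apply/funext => t; rewrite mulrA.
have avgU : \int[mu]_(t in `[- pi, pi]) (c * ek t * U t) <= x / 2.
  rewrite avg//; apply: (@le_trans _ _ (c * (x / 2 * I))); first by rewrite ler_pM2l.
  by rewrite mulrCA mulVf ?mulr1// gt_eqF.
have avg_cst (y : R) : \int[mu]_(t in `[- pi, pi]) (c * ek t * y) = y.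
  rewrite avg; last exact: ctsR_cst.
  rewrite (_ : (fun t => _) = (fun t => y * ek t)); last first.
    by apply/funext => t; rewrite mulrC.
  by rewrite ctsRintegralZ// mulrCA mulVf ?mulr1// gt_eqF.
have cck : continuous (fun t => c * ek t) by exact: cf.
have avgD (F G : R -> R) : continuous F -> continuous G ->
    \int[mu]_(t in `[- pi, pi]) (c * ek t * (F t + G t)) =
    \int[mu]_(t in `[- pi, pi]) (c * ek t * F t) +
    \int[mu]_(t in `[- pi, pi]) (c * ek t * G t).
  move=> cF cG; rewrite -ctsRintegralD; [|exact: ctsRM..].
  by congr (Rintegral _ _ _); apply/funext => t; rewrite mulrDr.
have avg_le (F G : R -> R) : continuous F -> continuous G -> (forall t, F t <= G t) ->
    \int[mu]_(t in `[- pi, pi]) (c * ek t * F t) <=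
    \int[mu]_(t in `[- pi, pi]) (c * ek t * G t).
  move=> cF cG FG; apply: cts_le_Rintegral; [exact: ctsRM..|move=> t _].
  by rewrite ler_pM2l//; exact: f_gt0.
have F10 : F1 0 <= x / 2.
  by rewrite /F1 p0; have := expR_ge1Dx (2 * - q); rewrite /q; clear; lra.
(* The phase at 0 is [- pi], so the cosine is -1 and [F2 0 = (1 + exp (- q))^2], with
   [exp (- q) >= 1 - q]. *)
have F20 : (2 - q) ^+ 2 <= F2 0.
  rewrite /F2 sqn_cexpB1 w0/= cosN cospi.
  have -> : expR (2 * - q) = expR (- q) * expR (- q).
    by rewrite -expRD; congr expR; ring.
  have := expR_ge1Dx (- q); rewrite /q.
  by move: (expR _) => y hy; clear -x0 x1 hy; nra.
exists (f, g) => /=; split.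
- by split=> t; exact: ltW.
- by split; exact: cts_integrable.
- by split; split; [exact: aeW|exact: cts_integrable|exact: aeW|exact: cts_integrable].
- split.
  + by rewrite nf.
  + rewrite -[leRHS]nf /normL1; apply: cts_le_Rintegral => [t|t|t _].
    * by apply: cvg_norm; exact: cg.
    * by apply: cvg_norm; exact: cf.
    rewrite !gtr0_norm// gE -fE ger_pMr// -[leRHS]expR0 ler_expR.
    by have := p_le0 t; clear; lra.
  + rewrite /normL1 (_ : (fun t => _) = (fun t => c * ek t * F1 t)); last first.
      apply/funext => t; rewrite gE fE distrC ger0_norm /F1; first by ring.
      rewrite -{1}[c * ek t]mulr1 -mulrBr; apply: mulr_ge0; last exact: F1_ge0.
      exact: ltW (f_gt0 t).
    apply: (@le_trans _ _ (\int[mu]_(t in `[- pi, pi]) (c * ek t * (F1 0 + U t)))).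
      apply: avg_le => // [|t]; first by apply: ctsRD => //; exact: ctsR_cst.
      rewrite -lerBlDl; apply: (le_trans (ler_norm _)).
      by rewrite /U lerDl.
    rewrite avgD//; last exact: ctsR_cst.
    by rewrite avg_cst; move: F10 avgU; clear; lra.
  + rewrite /normL1 (_ : (fun t => _) = (fun t => (2 * d) * r t)); last first.
      apply/funext => t; rewrite lng lnf addrAC subrr add0r ler0_norm /p; first by ring.
      by have := p_le0 t; rewrite /p; clear; lra.
    rewrite ctsRintegralZ// Rintegral_Re_coschwarz// /d.
    by rewrite le_eqVlt; apply/orP; left; apply/eqP; field; clear -pi0; lra.
(* Halved because [|f^+|^2 = f]: the logarithm of [f] is twice the real part of that of [f^+]. *)
pose h := ln c / 2.
have Ef t : ln (f (expi t)) = 2 * complex.Re (outer_log h K 0 0 (expi t)).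
  rewrite lnf /outer_log /h mul0r subr0.
  by simpc; rewrite /=; field.
have Eg t : ln (g (expi t)) = 2 * complex.Re (outer_log h K d a (expi t)).
  have -> : outer_log h K d a (expi t) = outer_log h K 0 0 (expi t) + w t.
    by rewrite /outer_log /w mul0r subr0.
  by rewrite raddfD/= mulrDr -Ef Rew lng lnf.
(* The boundary difference factors as [f^+ (exp w - 1)], and [|f^+|^2 = f] is recovered from
   [Ef]. *)
rewrite /normH2 (_ : (fun t => _) = (fun t => c * ek t * F2 t)); last first.
  apply/funext => t; rewrite (boundary_outer t a1 Ef Eg) -/(sqn _).
  have -> : outer_log h K d a (expi t) = outer_log h K 0 0 (expi t) + w t.
    by rewrite /outer_log /w mul0r subr0.
  rewrite cexpD -[X in _ - X]mulr1 -mulrBr sqnM sqn_cexp -Ef lnK//.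
  by rewrite posrE.
have -> : 2 - x = Num.sqrt ((2 - x) ^+ 2) by rewrite sqrtr_sqr ger0_norm//; clear -x1; lra.
apply: ler_wsqrtr.
(* With [q = x / 4], [(2 - q)^2 - x / 2] exceeds [(2 - x)^2] by [5 x / 2 - 15 x^2 / 16], which is
   positive for [0 < x <= 1]. *)
apply: (@le_trans _ _ (F2 0 - x / 2)).
  by move: F20; rewrite /q !expr2; clear -x0 x1; nra.
rewrite lerBlDr.
apply: (@le_trans _ _ (\int[mu]_(t in `[- pi, pi]) (c * ek t * (F2 t + U t)))).
  rewrite -{1}(avg_cst (F2 0)); apply: avg_le => [||t].
  - exact: ctsR_cst.
  - exact: ctsRD.
  rewrite -lerBlDl; apply: (le_trans (ler_norm _)).
  by rewrite distrC /U lerDr.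
by rewrite avgD// lerD2l.
Qed.

End Pair.

Theorem theorem1 (R : realType) :
  exists f g : nat -> R[i] -> R,
    forall n : nat, (0 < n)%N ->
      [/\ (forall t : R, 0 <= f n (expi t)) /\ (forall t : R, 0 <= g n (expi t)),
          L1T (f n) /\ L1T (g n),
          logL1T (f n) /\ logL1T (g n),
          [/\ normL1 (f n) <= 1, normL1 (g n) <= 1,
              normL1 (fun z => g n z - f n z) <= n%:R^-1 &
              normL1 (fun z => ln (g n z) - ln (f n z)) <= n%:R^-1] &
          normH2 (fun z => spectral_factor (g n) z - spectral_factor (f n) z)
            >= 2 - n%:R^-1].
Proof.
have pair (n : nat) : exists fg : (R[i] -> R) * (R[i] -> R), (0 < n)%N ->
    [/\ (forall t : R, 0 <= fg.1 (expi t)) /\ (forall t : R, 0 <= fg.2 (expi t)),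
        L1T fg.1 /\ L1T fg.2,
        logL1T fg.1 /\ logL1T fg.2,
        [/\ normL1 fg.1 <= 1, normL1 fg.2 <= 1,
            normL1 (fun z => fg.2 z - fg.1 z) <= n%:R^-1 &
            normL1 (fun z => ln (fg.2 z) - ln (fg.1 z)) <= n%:R^-1] &
        normH2 (fun z => spectral_factor fg.2 z - spectral_factor fg.1 z)
          >= 2 - n%:R^-1].
  (* [choice] wants a pair for every index; at [n = 0], where nothing is claimed, a dummy pair is
     supplied. *)
  have [->|n0] := posnP n; first by exists (fun=> 0, fun=> 0).
  have [||fg fgP] := @far_spectral_factors R n%:R^-1; last by exists fg.
    by rewrite invr_gt0 ltr0n.
  by rewrite invf_le1 ?ltr0n// ler1n.
have [fg fgP] := choice pair.
by exists (fun n => (fg n).1), (fun n => (fg n).2).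
Qed.
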